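(* There is a universal constant $\gamma_+$ (independent of the functions below) such that the following holds. Let $h,w:\mathbb Z^+\to\mathbb Z^+$ be functions with $h\succ1$ and $w\succ1$. If $w\prec\sqrt h$, then $L[h,w]\sim w^2\ln\left(\frac{\sqrt h}{w}\right)$. If $w\succ\sqrt h$, then $L[h,w]\sim\gamma_+w\sqrt h$.
   Context: For nonnegative integers $\eta_1,\dots,\eta_m$, a Kostant picture of height $\eta=(\eta_1,\dots,\eta_m)$ is a finite multiset of integer intervals $[i,j]\subseteq\{1,\dots,m\}$ ($i\le j$) such that every $t\in\{1,\dots,m\}$ lies in exactly $\eta_t$ of the intervals counted with multiplicity (equivalently a decomposition $\sum_t\eta_t\alpha_t=\sum_{i\le j}c_{ij}\alpha_{ij}$, $c_{ij}\in\mathbb N$, with $\alpha_{ij}=e_i-e_{j+1}\in\mathbb R^{m+1}$); $\mathcal K[\eta]$ is the set of these. For positive integers $h,w$, $[h,w]$ is the height $(h,\dots,h)$ with $w$ entries and $L[h,w]=\ln|\mathcal K[h,w]|$; equivalently $L[h,w]$ is the logarithm of the number of $w\times w$ upper-triangular nonnegative integer matrices with hook sum vector $(h,0,\dots,0)$. All functions are considered as the argument $n\to\infty$: $f\sim g$ means $f/g\to1$; $f\prec g$ ($g\succ f$) means $f/g\to0$. *)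

(* Defs.v *)
From HB Require Import structures.
From mathcomp Require Import all_boot all_order all_algebra finmap.
From mathcomp Require Import all_classical all_reals all_analysis.

Set Implicit Arguments.
Unset Strict Implicit.
Unset Printing Implicit Defensive.

Import Order.TTheory GRing.Theory Num.Theory.
Import numFieldNormedType.Exports.

Local Open Scope classical_set_scope.
Local Open Scope ring_scope.

(* The points 1, ..., m are represented by 'I_m, i.e. shifted to 0, ..., m-1;
   an interval [i, j] is the pair (i, j) with i <= j. *)
Definition int_interval (m : nat) : Type :=
  {ij : 'I_m * 'I_m | (ij.1 <= ij.2)%N}.

HB.instance Definition _ (m : nat) := Finite.on (int_interval m).

Definition covers (m : nat) (I : int_interval m) (t : 'I_m) : bool :=
  ((\val I).1 <= t <= (\val I).2)%N.

(* A multiset of intervals is given by its multiplicity function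
   I |-> c I (the c_{ij} of a Kostant partition). *)
Definition kostant_pictures (m : nat) (eta : 'I_m -> nat) :
    set {ffun int_interval m -> nat} :=
  [set c | forall t : 'I_m,
    (\sum_(I : int_interval m | covers I t) c I)%N = eta t].

(* [fset_set] returns the empty set on infinite sets, so the cardinality used
   in [num_kostant] is meaningful only because of this fact. *)
Lemma finite_kostant_pictures (m : nat) (eta : 'I_m -> nat) :
  finite_set (kostant_pictures eta).
Proof.
set N := (\max_(t < m) eta t)%N.
pose f (c : {ffun int_interval m -> 'I_N.+1}) : {ffun int_interval m -> nat} :=
  [ffun I => c I : nat].
apply: (sub_finite_set _ (finite_image f (@finite_finset _ setT))).
move=> c /= Hc; exists [ffun I => inord (c I)] => //.
apply/ffunP => I; rewrite !ffunE inordK // ltnS.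
apply: leq_trans (leq_bigmax (\val I).1).
rewrite -Hc (bigD1 I) /=; first exact: leq_addr.
by rewrite /covers leqnn (valP I).
Qed.

Definition num_kostant (m : nat) (eta : 'I_m -> nat) : nat :=
  #|` fset_set (kostant_pictures eta)|%fset.

Definition L {R : realType} (h w : nat) : R :=
  ln (num_kostant (fun _ : 'I_w => h))%:R.

Definition asym_equiv {R : realType} (f g : nat -> R) : Prop :=
  (fun n => f n / g n) @ \oo --> (1 : R).

Definition asym_prec {R : realType} (f g : nat -> R) : Prop :=
  (fun n => f n / g n) @ \oo --> (0 : R).

(* Main.v *)
(* Upper bounds come from the generating function: a picture has total length
   h w, so |K[h,w]| x^(h w) <= prod_I 1 / (1 - x^|I|) for 0 < x < 1.  With
   x = exp(-a) this reads ln |K[h,w]| <= a h w + sum_I f(a |I|), where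
   f(y) = -ln(1 - exp(-y)).  Lower bounds use that the one-point intervals are
   determined by the longer ones, so that it suffices to count multisets of
   intervals of length at least 2 covering every point at most h times.

   If w << sqrt h, take a = w / h above, and below let every multiplicity range
   freely up to h / w^2.

   If w >> sqrt h, let G be the supremum of the Riemann sums
   a sum_(i <= N) f(a i).  Since at most w intervals have a given length,
   ln |K[h,w]| <= w (a h + G / a), which is 2 w sqrt(G h) at a = sqrt(G / h);
   hence gamma = 2 sqrt G.  For the lower bound fix a and N, put
   rho_i = 1 / (exp(a i) - 1), and split the lengths into N blocks of g
   consecutive values.  At every starting point choose, for each i, a multiset
   of at most rho_i g lengths from the i-th block: the covering number never
   exceeds about g^2 sum_i i rho_i, which fixes g ~ sqrt h, and Stirling's
   formula evaluates the number of choices.  The resulting rate is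
   (S + a C) / sqrt C with S = sum_i f(a i) and C = sum_i i rho_i; by AM-GM it
   is at least 2 sqrt(a S), and a S is a Riemann sum. *)

Require Import Defs.
From mathcomp Require Import all_boot all_order all_algebra finmap.
From mathcomp Require Import all_classical all_reals all_analysis.
From mathcomp Require Import zify ring lra.

Set Implicit Arguments.
Unset Strict Implicit.
Unset Printing Implicit Defensive.

Import Order.TTheory GRing.Theory Num.Theory.
Import numFieldNormedType.Exports.
Local Open Scope ring_scope.

(** * Counting pictures *)

Definition ipoint {m : nat} (t : 'I_m) : int_interval m :=
  exist _ (t, t) (leqnn t).

Definition ilen {m : nat} (I : int_interval m) : nat :=
  ((\val I).2 - (\val I).1).+1.

Lemma in_kostant_pictures (m : nat) (eta : 'I_m -> nat)
    (c : {ffun int_interval m -> nat}) :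
  c \in fset_set (kostant_pictures eta) <->
  forall t : 'I_m, (\sum_(I : int_interval m | covers I t) c I)%N = eta t.
Proof.
rewrite in_fset_set ?inE; last exact: finite_kostant_pictures.
by split => [|H]; rewrite ?inE.
Qed.

(* The multiplicities of the one-point intervals are determined by those of
   the longer ones, which only have to satisfy an inequality. *)
Lemma card_le_num_kostant (m : nat) (eta : 'I_m -> nat) (U T : finType)
    (iota : U -> int_interval m) (v : T -> U -> nat) :
  injective iota ->
  (forall u, (\val (iota u)).1 != (\val (iota u)).2) ->
  (forall x y, v x =1 v y -> x = y) ->
  (forall x t, (\sum_(u | covers (iota u) t) v x u <= eta t)%N) ->
  (#|T| <= num_kostant eta)%N.
Proof.
move=> iota_inj iota_long v_inj v_le.
pose ext (x : T) (I : int_interval m) := (\sum_(u | iota u == I) v x u)%N.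
pose cov (x : T) t := (\sum_(u | covers (iota u) t) v x u)%N.
(* A one-point interval receives what its point still lacks; by the covering hypothesis the natural
   subtraction never truncates. *)
pose fill (x : T) : {ffun int_interval m -> nat} :=
  [ffun I => if (\val I).1 == (\val I).2 then (eta (\val I).1 - cov x (\val I).1)%N
             else ext x I].
have fillE x u : fill x (iota u) = v x u.
  rewrite ffunE (negbTE (iota_long u)) /ext (big_pred1 u) // => u' /=.
  by rewrite (inj_eq iota_inj).
have fill_inj : injective fill.
  by move=> x y exy; apply: v_inj => u; rewrite -!fillE exy.
have covE x t : (\sum_(I | covers I t && (I != ipoint t)) fill x I = cov x t)%N.
  rewrite /cov (partition_big iota (fun I => covers I t && (I != ipoint t))) /=; last first.
    move=> u ->; apply/eqP => e; have := iota_long u.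
    by rewrite e /= eqxx.
  apply: eq_bigr => I /andP[cI nI]; rewrite ffunE ifN; last first.
    apply: contraNN nI => /eqP e; apply/eqP/val_inj => /=.
    move: cI; rewrite /covers -e -eqn_leq => /eqP te.
    by rewrite [LHS]surjective_pairing -e; congr (_, _); apply: val_inj.
  by apply: eq_bigl => u; case: eqP => [->|_]; rewrite ?cI ?andbF.
have fillP x : fill x \in fset_set (kostant_pictures eta).
  apply/in_kostant_pictures => t.
  rewrite (bigD1 (ipoint t)) /=; last by rewrite /covers /= leqnn.
  by rewrite covE ffunE /= eqxx subnK //; exact: v_le.
rewrite cardE -(size_map fill); apply: uniq_leq_size.
  by rewrite map_inj_uniq ?enum_uniq.
by move=> _ /mapP[x _ ->]; exact: fillP.
Qed.

Lemma sum_ord_itv (m a b : nat) :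
  (b <= m)%N -> (\sum_(t < m | a <= t < b) 1 = b - a)%N.
Proof.
move=> bm; rewrite -(big_mkord (fun t => a <= t < b)%N (fun=> 1%N)).
rewrite -(@big_nat_widen _ _ _ 0 b m (fun t => a <= t)%N) //.
by rewrite -(@big_nat_widenl _ _ _ a 0 b xpredT) // sum_nat_const_nat muln1.
Qed.

Lemma sum_ord_itv_le (m a b : nat) : (\sum_(t < m | a <= t < b) 1 <= b - a)%N.
Proof.
rewrite (eq_bigl (fun t : 'I_m => a <= t < minn b m)%N); last first.
  by move=> t; rewrite leq_min (ltn_ord t) andbT.
by rewrite sum_ord_itv ?geq_minr // leq_sub2r // geq_minl.
Qed.

(** * The generating function bound *)

Lemma sum_ilen (m : nat) (eta : 'I_m -> nat) (c : {ffun int_interval m -> nat}) :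
  c \in fset_set (kostant_pictures eta) ->
  (\sum_(I : int_interval m) ilen I * c I = \sum_t eta t)%N.
Proof.
move=> /in_kostant_pictures cP.
under [RHS]eq_bigr => t _ do rewrite -cP big_mkcond.
rewrite exchange_big /=; apply: eq_bigr => I _.
rewrite -big_mkcond /= sum_nat_const -sum1_card; congr (_ * _)%N.
have le12 := valP I.
by rewrite /ilen -subSn // -(@sum_ord_itv m).
Qed.

(** Every factor on the right is a geometric series. Expanding the product gives one power of [x]
    per multiplicity function, and each picture contributes [x] to its total length. *)
Lemma num_kostant_gf (R : realType) (m : nat) (eta : 'I_m -> nat) (x : R) :
  0 < x < 1 ->
  (num_kostant eta)%:R * x ^+ (\sum_t eta t)%N <=
  \prod_(I : int_interval m) (1 - x ^+ ilen I)^-1.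
Proof.
move=> /andP[x0 x1]; set S := fset_set (kostant_pictures eta).
(* [N] bounds every multiplicity in every picture, so no picture is lost when the series are
   truncated and the expansion is finite. *)
pose N := (\max_(c <- S) \max_I c I)%N.
have cN c I : c \in S -> (c I <= N)%N.
  move=> cS; apply: leq_trans (leq_bigmax_seq _ cS isT) => /=.
  exact: leq_bigmax.
pose tr (c : {ffun int_interval m -> nat}) : {ffun int_interval m -> 'I_N.+1} :=
  [ffun I => inord (c I)].
have trE c I : c \in S -> tr c I = c I :> nat.
  by move=> cS; rewrite ffunE inordK ?ltnS ?cN.
have tr_inj : {in S &, injective tr}.
  move=> c d cS dS e; apply/ffunP => I.
  by rewrite -(trE c) // e trE.
pose F (d : {ffun int_interval m -> 'I_N.+1}) : R :=
  \prod_(I : int_interval m) (x ^+ ilen I) ^+ d I.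
have F0 d : 0 <= F d by apply: prodr_ge0 => I _; rewrite !exprn_ge0 ?ltW.
have -> : (num_kostant eta)%:R * x ^+ (\sum_t eta t)%N = \sum_(d <- map tr S) F d.
  rewrite big_map (eq_big_seq (fun=> x ^+ (\sum_t eta t)%N)); last first.
    move=> c cS; rewrite -(sum_ilen cS) -prodrXr; apply: eq_bigr => I _.
    by rewrite exprM trE.
  by rewrite big_const_seq count_predT iter_addr_0 mulr_natl.
rewrite big_uniq ?map_inj_in_uniq ?fset_uniq //=.
apply: (@le_trans _ _ (\sum_d F d)).
  by rewrite [leRHS](bigID (mem (map tr S))) /= lerDl sumr_ge0.
rewrite -(@bigA_distr_bigA _ _ _ _ _ _ _ (fun I (k : 'I_N.+1) => (x ^+ ilen I) ^+ k)).
apply: ler_prod => I _; rewrite sumr_ge0 /=; last by move=> k _; rewrite !exprn_ge0 ?ltW.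
set y := x ^+ ilen I.
have y1 : y < 1 by rewrite exprn_ilt1 ?ltW.
have y0 : 0 <= y by rewrite exprn_ge0 ?ltW.
rewrite -[leRHS]mul1r ler_pdivlMr ?subr_gt0 // mulrC -(opprB y) mulNr -subrX1.
by rewrite opprB lerBlDr lerDl exprn_ge0.
Qed.

Definition bose {R : realType} (x : R) : R := - ln (1 - expR (- x)).

Lemma L_le (R : realType) (h w : nat) (a : R) : 0 < a ->
  L h w <= a * h%:R * w%:R + \sum_(I : int_interval w) bose (a * (ilen I)%:R).
Proof.
move=> a0; rewrite /L; set K := num_kostant _.
have [->|K0] := posnP K; last first.
  have x01 : 0 < expR (- a) < 1 by rewrite expR_gt0 expR_lt1 oppr_lt0.
  have y1 I : 0 < 1 - expR (- (a * (@ilen w I)%:R)).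
    by rewrite subr_gt0 expR_lt1 oppr_lt0 mulr_gt0 ?ltr0n.
  have := num_kostant_gf (fun _ : 'I_w => h) x01; rewrite -/K.
  rewrite sum_nat_const card_ord -expRM_natl.
  under eq_bigr => I _ do rewrite -expRM_natl mulrN mulrC.
  rewrite -ler_ln ?posrE ?mulr_gt0 ?ltr0n ?expR_gt0 ?prodr_gt0 //; last first.
    by move=> I _; rewrite invr_gt0.
  rewrite lnM ?posrE ?expR_gt0 ?ltr0n // expRK.
  have -> : ln (\prod_(I : int_interval w) (1 - expR (- (a * (ilen I)%:R)))^-1) =
     \sum_(I : int_interval w) bose (a * (ilen I)%:R).
    (* Positivity is carried through the induction because [lnM] requires it. *)
    suff [] : 0 < \prod_(I : int_interval w) (1 - expR (- (a * (ilen I)%:R)))^-1 /\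
      ln (\prod_(I : int_interval w) (1 - expR (- (a * (ilen I)%:R)))^-1) =
      \sum_(I : int_interval w) bose (a * (ilen I)%:R) by [].
    apply: (big_ind2 (fun p s => 0 < p /\ ln p = s)); first by rewrite ln1.
    - by move=> p1 s1 p2 s2 [p10 <-] [p20 <-]; rewrite mulr_gt0 // lnM.
    - by move=> I _; rewrite invr_gt0 lnV ?posrE.
  rewrite natrM; lra.
(* Here [K = 0] and [ln 0 = 0] by convention, so only the sign of the bound is at stake. *)
rewrite ln0 //; apply: addr_ge0; first by rewrite !mulr_ge0 ?ler0n // ltW.
apply: sumr_ge0 => I _; rewrite oppr_ge0 ln_le0 // gerBl expR_ge0.
Qed.

Lemma sum_intervals (R : nmodType) (w : nat) (F : nat -> nat -> R) :
  \sum_(I : int_interval w) F (\val I).1 (\val I).2 =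
  \sum_(i < w) \sum_(j < w | (i <= j)%N) F i j.
Proof.
rewrite pair_big_dep /= (big_sub [pred p : 'I_w * 'I_w | p.1 <= p.2]%N) /=.
by [].
Qed.

(** Each of the [w] left endpoints starts at most one interval of a given length. *)
Lemma sum_ilen_fun_le (R : realType) (w : nat) (f : nat -> R) :
  (forall l, 0 <= f l) ->
  \sum_(I : int_interval w) f (ilen I) <= w%:R * \sum_(l < w) f l.+1.
Proof.
move=> f0; rewrite (sum_intervals _ (fun i j => f (j - i).+1)).
rewrite mulr_natl -[X in _ *+ X](card_ord w) -sumr_const.
apply: ler_sum => i _.
rewrite -(big_mkord (fun j => i <= j)%N (fun j => f (j - i).+1)) /=.
rewrite -(@big_nat_widenl _ _ _ i 0 w xpredT) //.
rewrite -[X in \big[_/_]_(X <= _ < _ | _) _]add0n big_addn.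
rewrite big_mkord.
rewrite (big_ord_widen w (fun l => f (l + i - i).+1)) ?leq_subr //.
rewrite big_mkcond /=; apply: ler_sum => l _; rewrite addnK.
by case: ifP.
Qed.

Lemma card_int_interval (w : nat) : #|{: int_interval w}| = 'C(w.+1, 2).
Proof.
rewrite -sum1_card (sum_intervals _ (fun _ _ => 1%N)).
under eq_bigr => i _.
  rewrite (eq_bigl (fun j : 'I_w => i <= j < w)%N); last by move=> j; rewrite ltn_ord andbT.
  rewrite sum_ord_itv //.
  over.
rewrite -bin2_sum big_mkord big_ord_recl add0n (reindex_inj rev_ord_inj) /=.
by apply: eq_bigr => i _; rewrite /bump subKn.
Qed.

Lemma card_long_interval (w : nat) :
  #|{: {I : int_interval w | (\val I).1 != (\val I).2}}| = 'C(w, 2).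
Proof.
rewrite card_sig -sum1_card big_mkcond /=.
rewrite (sum_intervals _ (fun i j => if i != j then 1 else 0)%N).
rewrite -bin2_sum big_mkord (reindex_inj rev_ord_inj) /=.
apply: eq_bigr => i _; rewrite -big_mkcondr /=.
rewrite (eq_bigl (fun j : 'I_w => (w - i.+1).+1 <= j < w)%N); last first.
  by move=> j; rewrite ltn_ord andbT ltn_neqAle andbC.
by rewrite sum_ord_itv // subnSK // subKn // ltnW.
Qed.

Lemma num_kostant_ge_exp (h w b : nat) :
  (b * (w * w) <= h)%N -> (b.+1 ^ 'C(w, 2) <= num_kostant (fun _ : 'I_w => h))%N.
Proof.
move=> bh; pose U := {I : int_interval w | (\val I).1 != (\val I).2}.
rewrite -card_long_interval -{1}(card_ord b.+1) -card_ffun.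
apply: (@card_le_num_kostant _ _ U {ffun U -> 'I_b.+1} val (fun f u => f u : nat)).
- exact: val_inj.
- by move=> u; exact: (valP u).
- by move=> f g fg; apply/ffunP => u; apply: val_inj; exact: fg.
move=> f t; apply: leq_trans bh.
apply: (@leq_trans (\sum_(u : U) b)%N).
  rewrite big_mkcond; apply: leq_sum => u _.
  by case: ifP => // _; rewrite -ltnS.
rewrite sum_nat_const mulnC leq_mul2l; apply/orP; right.
have -> : (w * w = #|{: 'I_w * 'I_w}|)%N by rewrite card_prod card_ord.
apply: (@leq_trans #|{: int_interval w}|).
  by rewrite card_sig; exact: max_card.
by rewrite card_sig; exact: max_card.
Qed.

(** Stars and bars, with the slack of the inequality as one more part. Bounding each entry by [n]
    loses nothing and keeps the type finite. *)
Lemma card_bounded_tuple (m n : nat) :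
  #|{: {t : m.-tuple 'I_n.+1 | (\sum_(k <- t) k <= n)%N}}| = 'C(m + n, m).
Proof. by rewrite -card_partial_ord_partitions card_sig cardsE. Qed.

(** There are [n] starting points and [m] blocks of [g] consecutive lengths; [r i] caps the total
    multiplicity taken from block [i] at each start. *)
Lemma num_kostant_ge_bin (h w n m g : nat) (r : nat -> nat) :
  (n + m * g <= w)%N ->
  (\sum_(i < m) r i * (i.+1 * g).+1 <= h)%N ->
  ((\prod_(i < m) 'C(g + r i, g)) ^ n <= num_kostant (fun _ : 'I_w => h))%N.
Proof.
move=> nw rh.
pose V (p : 'I_n * 'I_m) :=
  {t : g.-tuple 'I_(r p.2).+1 | (\sum_(k <- t) k <= r p.2)%N}.
pose T := {dffun forall p, V p}.
pose U : finType := ('I_n * 'I_m * 'I_g)%type.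
have cardT : #|{: T}| = ((\prod_(i < m) 'C(g + r i, g)) ^ n)%N.
  rewrite card_dep_ffun foldrE big_image /=.
  under eq_bigr => p _.
    rewrite card_bounded_tuple.
    over.
  rewrite -(pair_bigA _ (fun (s : 'I_n) (i : 'I_m) => 'C(g + r i, g))) /=.
  by rewrite prod_nat_const card_ord.
(* The successor makes every length at least 2; one-point intervals are reserved for filling up. *)
pose e (u : U) := (u.1.1 + (u.1.2 * g + u.2).+1)%N.
have ew (u : U) : (e u < w)%N.
  apply: leq_trans nw; rewrite /e.
  case: u => [[s i] j] /=; have := ltn_ord s; have := ltn_ord j.
  have : (i.+1 * g <= m * g)%N by rewrite leq_mul2r ltn_ord orbT.
  rewrite mulSn; lia.
have sw (u : U) : (u.1.1 < w)%N by apply: leq_ltn_trans (ew u); exact: leq_addr.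
pose iota (u : U) : int_interval w :=
  exist _ (Ordinal (sw u), Ordinal (ew u)) (leq_addr _ _).
rewrite -cardT.
apply: (@card_le_num_kostant _ _ U T iota (fun f u => tnth (val (f u.1)) u.2 : nat)).
- move=> [[s i] j] [[s' i'] j'] /(congr1 val) [] /= es; rewrite /e /= es.
  move=> /addnI [] eij.
  have g0 : (0 < g)%N by exact: leq_ltn_trans (ltn_ord j).
  (* [i] and [j] are the quotient and remainder of the offset by [g]. *)
  have ei : i = i' :> nat.
    have := congr1 (fun k => k %/ g)%N eij.
    by rewrite !divnMDl // !divn_small // !addn0.
  have ej : j = j' :> nat by move: eij; rewrite ei => /addnI.
  by congr (_, _, _); apply: val_inj.
- by move=> u /=; rewrite -val_eqE /= /e neq_ltn addnS ltnS leq_addr.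
- move=> f f' ff'; apply/ffunP => p; apply: val_inj; apply: eq_from_tnth => j.
  by apply: val_inj; exact: (ff' (p, j)).
move=> f t; apply: leq_trans rh.
(* An interval of block [i] starting at [s] ends by [s + i.+1 * g], so at most [(i.+1 * g).+1]
   starting points reach [t]. *)
pose hit (p : 'I_n * 'I_m) := (t - p.2.+1 * g <= p.1 < t.+1)%N.
apply: (@leq_trans (\sum_(u : U) if hit u.1 then (tnth (val (f u.1)) u.2 : nat) else 0)%N).
  rewrite big_mkcond; apply: leq_sum => -[[s i] j] _ /=.
  rewrite /covers /hit /= /e /= ltnS; case: ifP => // /andP[-> tle] /=.
  rewrite andbT ifT // leq_subLR; apply: leq_trans tle _.
  by rewrite [leqRHS]addnC leq_add2l mulSn -addnS addnC leq_add2r.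
rewrite -(pair_bigA _ (fun p j => if hit p then (tnth (val (f p)) j : nat) else 0)%N) /=.
apply: (@leq_trans (\sum_(p : 'I_n * 'I_m) if hit p then r p.2 else 0)%N).
  apply: leq_sum => p _; case: ifP => _; last by rewrite big1.
  by rewrite -(big_tuple _ _ (val (f p)) xpredT (fun k => k : nat)); exact: (valP (f p)).
rewrite -(pair_bigA _ (fun (s : 'I_n) (i : 'I_m) => if hit (s, i) then r i else 0)%N) /=.
rewrite exchange_big /=; apply: leq_sum => i _.
rewrite -big_mkcond /= sum_nat_const mulnC leq_mul2l; apply/orP; right.
rewrite -sum1_card (eq_bigl (fun s : 'I_n => t - i.+1 * g <= s < t.+1)%N) //.
by apply: leq_trans (sum_ord_itv_le _ _ _) _; lia.
Qed.

(** * Upper bounds and the thick regime *)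

Section bose.
Context {R : realType}.
Implicit Types x y a : R.

(** For [x <= 0] this rests on the convention that [ln] vanishes at nonpositive arguments. *)
Lemma bose_ge0 x : 0 <= bose x.
Proof. by rewrite oppr_ge0 ln_le0 // gerBl expR_ge0. Qed.

Lemma bose_gt0 x : 0 < x -> 0 < bose x.
Proof.
move=> x0; rewrite oppr_gt0 ln_lt0 // subr_gt0 expR_lt1 oppr_lt0 x0 /=.
by rewrite ltrBlDr ltrDl expR_gt0.
Qed.

Lemma boseE x : 0 < x -> bose x = ln (1 + (expR x - 1)^-1).
Proof.
move=> x0; have e1 : 1 < expR x by rewrite expR_gt1.
have e0 := expR_gt0 x.
have x1 : 0 < 1 - expR (- x) by rewrite subr_gt0 expR_lt1 oppr_lt0.
rewrite /bose -lnV ?posrE //; congr ln; rewrite expRN; field.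
by rewrite !gt_eqF ?subr_gt0.
Qed.

Lemma bose_le x : 0 < x -> bose x <= ln (1 + x^-1).
Proof.
move=> x0; rewrite boseE //; have e1 : x <= expR x - 1.
  by rewrite lerBrDl expR_ge1Dx.
have e0 : 0 < expR x - 1 by apply: lt_le_trans e1.
by rewrite ler_ln ?posrE ?addr_gt0 ?invr_gt0 // lerD2l lef_pV2 ?posrE.
Qed.

Lemma ln1D_le_sqrt y : 0 <= y -> ln (1 + y) <= 2 * Num.sqrt y.
Proof.
move=> y0; have s0 := sqrtr_ge0 y.
have h : ln (1 + y) <= ln ((1 + Num.sqrt y) ^+ 2).
  rewrite ler_ln ?posrE ?exprn_gt0; [|lra..].
  by rewrite -{1}(sqr_sqrtr y0); nra.
apply: (le_trans h); rewrite lnXn; last by lra.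
have := @le_ln1Dx R (Num.sqrt y) ltac:(lra).
by rewrite mulr2n; lra.
Qed.

(** One algebraic bound covers the singularity at 0 and the decay at infinity. It is shaped for
    integration in [u ^+ 2]: multiplied by [2 * u] it is the derivative of [40 * (u / (1 + u))]. *)
Lemma bose_le_sqrt (u : R) : 0 < u -> bose (u ^+ 2) <= 20 / (u * (1 + u) ^+ 2).
Proof.
move=> u0; have x0 : 0 < u ^+ 2 by rewrite exprn_gt0.
set d := u * (1 + u) ^+ 2; have d0 : 0 < d by rewrite mulr_gt0 // exprn_gt0; lra.
have e3 : 1 + (u ^+ 2) ^+ 3 / 3`!%:R <= expR (u ^+ 2) by apply: expR_ge1Dxn; exact: ltW.
have e1 := expR_ge1Dx (u ^+ 2).
(* With [x = u ^+ 2], averaging [e1] and [e3] yields at least [(x + x ^+ 3) / 12]; the 10 comes from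
   [h4] and [8 / 100 <= 1 / 12]. *)
have ed : (d / 10) ^+ 2 <= expR (u ^+ 2) - 1.
  apply: (@le_trans _ _ ((u ^+ 2 + (u ^+ 2) ^+ 3) / 12)); last first.
    have : (3`!%:R : R) = 6 by []. 
    move=> E; rewrite E in e3; nra.
  have h4 : (1 + u) ^+ 4 <= 8 * (1 + u ^+ 4).
    rewrite -subr_ge0.
    have -> : 8 * (1 + u ^+ 4) - (1 + u) ^+ 4 =
      (u - 1) ^+ 2 * (7 * u ^+ 2 + 10 * u + 7) by ring.
    by rewrite mulr_ge0 ?sqr_ge0 //; nra.
  have -> : (d / 10) ^+ 2 = u ^+ 2 * (1 + u) ^+ 4 / 100 by rewrite /d; field.
  have : u ^+ 2 * (1 + u) ^+ 4 <= u ^+ 2 * (8 * (1 + u ^+ 4)) by rewrite ler_pM2l.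
  have -> : u ^+ 2 * (8 * (1 + u ^+ 4)) = 8 * (u ^+ 2 + (u ^+ 2) ^+ 3) by ring.
  have : 0 < (u ^+ 2) ^+ 3 by rewrite exprn_gt0.
  lra.
have d10 : 0 < (d / 10) ^+ 2 by rewrite exprn_gt0 // divr_gt0.
rewrite boseE //; apply: (@le_trans _ _ (ln (1 + (10 / d) ^+ 2))).
  have z0 : 0 < expR (u ^+ 2) - 1 by apply: lt_le_trans ed.
  rewrite ler_ln ?posrE ?addr_gt0 ?invr_gt0 ?exprn_gt0 ?divr_gt0 //.
  have -> : (10 / d) ^+ 2 = ((d / 10) ^+ 2)^-1 by field; rewrite gt_eqF.
  by rewrite lerD2l lef_pV2 ?posrE.
apply: le_trans (ln1D_le_sqrt (sqr_ge0 _)) _.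
have -> : 20 / d = 2 * (10 / d) by field; rewrite gt_eqF.
by rewrite sqrtr_sqr ger0_norm // divr_ge0 // ltW.
Qed.

(** * Riemann sums of [bose] and the thin upper bound *)

Definition riemann a (N : nat) : R := a * \sum_(i < N) bose (a * i.+1%:R).

(** Discrete form of that integration: [a = (u - v) * (u + v) <= (u - v) * (2 * u)] bounds the new
    term by the increment of the right-hand side. *)
Lemma riemann_le a N : 0 < a ->
  riemann a N <= 40 * (Num.sqrt (a * N%:R) / (1 + Num.sqrt (a * N%:R))).
Proof.
move=> a0; rewrite /riemann; elim: N => [|N IH].
  by rewrite big_ord0 !mulr0 sqrtr0 mul0r mulr0.
rewrite big_ord_recr /= mulrDr.
set v := Num.sqrt (a * N%:R) in IH *; set u := Num.sqrt (a * N.+1%:R).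
have v0 : 0 <= v by rewrite sqrtr_ge0.
have u0 : 0 < u by rewrite sqrtr_gt0 mulr_gt0.
have v2 : v ^+ 2 = a * N%:R by rewrite sqr_sqrtr // mulr_ge0 // ltW.
have u2 : u ^+ 2 = a * N.+1%:R by rewrite sqr_sqrtr // mulr_ge0 // ltW.
have au : a = (u - v) * (u + v).
  by rewrite -subr_sqr u2 v2 -mulrBr -natrB // subSnn mulr1.
have uv : 0 < u - v.
  by move: a0; rewrite au pmulr_lgt0 //; lra.
have -> : u / (1 + u) = v / (1 + v) + (u - v) / ((1 + u) * (1 + v)).
  by field; rewrite !gt_eqF; lra.
rewrite mulrDr; apply: lerD => //; rewrite -u2.
apply: le_trans (_ : a * (20 / (u * (1 + u) ^+ 2)) <= _).
  by rewrite ler_pM2l // bose_le_sqrt.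
rewrite {1}au.
apply: (@le_trans _ _ (40 * ((u - v) / ((1 + u) * (1 + u))))); last first.
  rewrite ler_pM2l // ler_pM2l // lef_pV2 ?posrE ?mulr_gt0 //; [|lra..].
  by rewrite ler_pM2l //; lra.
apply: (@le_trans _ _ ((u - v) * (2 * u) * (20 / (u * (1 + u) ^+ 2)))).
  rewrite ler_pM2r; last by rewrite divr_gt0 // mulr_gt0 // exprn_gt0 //; lra.
  by rewrite ler_pM2l //; lra.
rewrite le_eqVlt; apply/orP; left; apply/eqP; field.
by rewrite !gt_eqF //; lra.
Qed.

(** This is the integral of [bose] over the positive half-line, [pi ^ 2 / 6]: [bose] decreases, so
    right-endpoint sums approach it from below. *)
Definition riemann_sup : R :=
  sup [set y | exists a N, 0 < a /\ y = riemann a N].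

Lemma has_sup_riemann : has_sup [set y | exists a N, 0 < a /\ y = riemann a N].
Proof.
split; first by exists (riemann 1 0), 1, 0%N.
exists 40 => _ [a [N [a0 ->]]]; apply: le_trans (riemann_le N a0) _.
have := sqrtr_ge0 (a * N%:R); set s := Num.sqrt _ => s0.
by rewrite -[leRHS]mulr1 ler_pM2l // ler_pdivrMr; lra.
Qed.

Lemma riemann_le_sup a N : 0 < a -> riemann a N <= riemann_sup.
Proof.
move=> a0; apply: ub_le_sup; first by case: has_sup_riemann.
by exists a, N.
Qed.

Lemma riemann_sup_gt0 : 0 < riemann_sup.
Proof.
apply: lt_le_trans (riemann_le_sup 1 ltr01).
by rewrite /riemann big_ord1 !mul1r bose_gt0.
Qed.

Lemma L_le_thin (h w : nat) : (0 < h)%N ->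
  L h w <= 2 * Num.sqrt riemann_sup * w%:R * Num.sqrt h%:R.
Proof.
move=> h0; have G0 := riemann_sup_gt0.
set s := Num.sqrt riemann_sup; set q : R := Num.sqrt h%:R.
have s0 : 0 < s by rewrite sqrtr_gt0.
have q0 : 0 < q by rewrite sqrtr_gt0 ltr0n.
have s2 : s ^+ 2 = riemann_sup by rewrite sqr_sqrtr // ltW.
have q2 : q ^+ 2 = h%:R by rewrite sqr_sqrtr.
(* The choice [a = s / q] balances [a * h] against [riemann_sup / a]: both equal [s * q]. *)
have a0 : 0 < s / q by rewrite divr_gt0.
apply: le_trans (L_le h w a0) _.
apply: (@le_trans _ _ (s / q * h%:R * w%:R + w%:R * (s * q))); last first.
  rewrite -q2 le_eqVlt; apply/orP; left; apply/eqP; field.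
  by rewrite gt_eqF.
rewrite lerD2l; apply: le_trans (@sum_ilen_fun_le _ w (fun l => bose (s / q * l%:R)) _) _.
  by move=> l; exact: bose_ge0.
apply: ler_wpM2l => //.
have := riemann_le_sup w a0; rewrite /riemann -s2.
rewrite mulrC -ler_pdivlMr //.
have -> // : s ^+ 2 / (s / q) = s * q.
by field; rewrite !gt_eqF.
Qed.

(** * Two-sided bounds in the thick regime *)

Lemma sum_sqrtV_le (w : nat) :
  \sum_(l < w) (Num.sqrt l.+1%:R)^-1 <= 2 * Num.sqrt w%:R :> R.
Proof.
elim: w => [|w IH]; first by rewrite big_ord0 sqrtr0 mulr0.
rewrite big_ord_recr /=; apply: le_trans (lerD IH (lexx _)) _.
set u : R := Num.sqrt w.+1%:R; set v : R := Num.sqrt w%:R.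
have u0 : 0 < u by rewrite sqrtr_gt0.
have v0 : 0 <= v by rewrite sqrtr_ge0.
have u2 : u ^+ 2 = w.+1%:R by rewrite sqr_sqrtr.
have v2 : v ^+ 2 = w%:R by rewrite sqr_sqrtr.
have uv : u ^+ 2 = v ^+ 2 + 1 by rewrite u2 v2 -addn1 natrD.
rewrite -lerBrDl -div1r ler_pdivrMr //; nra.
Qed.

(** At [a = w / h] the linear term is [w ^+ 2]. Since [h / w ^+ 2 >= 1], it factors out of
    [1 + h / (w * l)] and leaves at most [1 + w / l]; the logarithms of the latter sum to at most
    [4 * w ^+ 2]. *)
Lemma L_le_thick (h w : nat) : (0 < w)%N -> (w * w <= h)%N ->
  L h w <= 5 * w%:R ^+ 2 + 'C(w.+1, 2)%:R * ln (h%:R / w%:R ^+ 2) :> R.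
Proof.
move=> w0 wh.
have W0 : 0 < w%:R :> R by rewrite ltr0n.
have h0 : (0 < h)%N by apply: leq_trans wh; rewrite muln_gt0 w0.
have H0 : 0 < h%:R :> R by rewrite ltr0n.
have wh' : 1 <= h%:R / w%:R ^+ 2 :> R.
  by rewrite ler_pdivlMr ?exprn_gt0 // mul1r expr2 -natrM ler_nat.
have a0 : 0 < w%:R / h%:R :> R by rewrite divr_gt0.
apply: le_trans (L_le h w a0) _.
have -> : w%:R / h%:R * h%:R * w%:R = w%:R ^+ 2 :> R by field; rewrite gt_eqF.
have -> : 5 * w%:R ^+ 2 = w%:R ^+ 2 + 4 * w%:R ^+ 2 :> R by ring.
rewrite -addrA lerD2l.
set c := ln _.
have hc (I : int_interval w) :
    bose (w%:R / h%:R * (ilen I)%:R) <= c + 2 * (Num.sqrt w%:R / Num.sqrt (ilen I)%:R).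
  have l0 : 0 < (ilen I)%:R :> R by rewrite ltr0n.
  have q0 : 0 < w%:R / (ilen I)%:R :> R by rewrite divr_gt0.
  apply: le_trans (bose_le _) _; first by rewrite mulr_gt0.
  apply: (@le_trans _ _ (c + ln (1 + w%:R / (ilen I)%:R))).
    rewrite -lnM ?posrE ?divr_gt0 ?exprn_gt0 ?addr_gt0 //.
    rewrite ler_ln ?posrE ?mulr_gt0 ?addr_gt0 ?invr_gt0 ?mulr_gt0 ?divr_gt0 ?invr_gt0 ?exprn_gt0 //.
    rewrite mulrDr mulr1; apply: lerD => //.
    rewrite le_eqVlt; apply/orP; left; apply/eqP; field.
    by rewrite !gt_eqF.
  rewrite lerD2l; apply: le_trans (ln1D_le_sqrt _) _; first by rewrite divr_ge0.
  by rewrite sqrtrM // sqrtrV.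
apply: (@le_trans _ _ (\sum_(I : int_interval w)
    (c + 2 * (Num.sqrt w%:R / Num.sqrt (ilen I)%:R)))).
  by apply: ler_sum => I _; exact: hc.
rewrite big_split /= sumr_const card_int_interval -[c *+ _]mulr_natl addrC lerD2r.
apply: le_trans (@sum_ilen_fun_le _ w (fun l => 2 * (Num.sqrt w%:R / Num.sqrt l%:R)) _) _.
  by move=> l; rewrite mulr_ge0 // divr_ge0 ?sqrtr_ge0.
rewrite -mulr_sumr -mulr_sumr.
have -> : 4 * w%:R ^+ 2 = w%:R * (2 * (Num.sqrt w%:R * (2 * Num.sqrt w%:R))) :> R.
  have : Num.sqrt w%:R ^+ 2 = w%:R :> R by rewrite sqr_sqrtr.
  set z := Num.sqrt _ => <-; ring.
by rewrite !ler_wpM2l ?sqrtr_ge0 // sum_sqrtV_le.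
Qed.

Lemma L_ge_thick (h w : nat) : (0 < w)%N -> (0 < h)%N ->
  'C(w, 2)%:R * ln (h%:R / w%:R ^+ 2) <= L h w :> R.
Proof.
(* The multiplicity 0 makes [b.+1] choices, which compensates the floor: [b.+1] exceeds
   [h / w ^+ 2]. *)
move=> w0 h0; set b := (h %/ (w * w))%N.
have ww0 : (0 < w * w)%N by rewrite muln_gt0 w0.
have Kb := @num_kostant_ge_exp h w b (leq_trunc_div h (w * w)).
apply: (@le_trans _ _ (ln (b.+1 ^ 'C(w, 2))%:R)); last first.
  have b0 : (0 < b.+1 ^ 'C(w, 2))%N by rewrite expn_gt0.
  rewrite /L ler_ln ?posrE ?ltr0n ?ler_nat //.
  exact: leq_trans Kb.
rewrite natrX lnXn ?ltr0n // -[leRHS]mulr_natl ler_wpM2l //.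
have W2 : 0 < w%:R ^+ 2 :> R by rewrite exprn_gt0 // ltr0n.
rewrite ler_ln ?posrE ?divr_gt0 ?ltr0n //.
rewrite ler_pdivrMr // expr2 -!natrM ler_nat ltnW //.
by rewrite /b -ltn_divLR.
Qed.

End bose.
(** * The lower bound in the thin regime *)

Section thin.
Local Open Scope classical_set_scope.
Context {R : realType}.
Implicit Types x y a rho : R.

(** * Stirling bounds and the growth rate of one block *)

Lemma ln_fact_ge (n : nat) : n%:R * ln n%:R - n%:R <= ln n`!%:R :> R.
Proof.
elim: n => [|n IH]; first by rewrite mul0r fact0 ln1 subr0.
rewrite factS natrM lnM ?posrE ?ltr0n ?fact_gt0 //.
have [->|n0] := posnP n; first by rewrite fact0 ln1 mul1r addr0 gerBl.
have N0 : 0 < n%:R :> R by rewrite ltr0n.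
have : ln (1 + n%:R^-1) <= n%:R^-1 :> R.
  by rewrite le_ln1Dx // (lt_trans _ (_ : 0 < _)) // ?invr_gt0.
have -> : 1 + n%:R^-1 = n.+1%:R / n%:R :> R.
  by rewrite -addn1 natrD; field; rewrite gt_eqF.
rewrite ln_div ?posrE ?ltr0n // -(ler_pM2l N0) divff ?gt_eqF //.
move: IH; rewrite -[n.+1]addn1 natrD; nra.
Qed.

(** The shift to [n.+1] loses only a logarithmic term against [ln_fact_ge]. *)
Lemma ln_fact_le (n : nat) : ln n`!%:R <= n.+1%:R * ln n.+1%:R - n%:R :> R.
Proof.
elim: n => [|n IH]; first by rewrite fact0 ln1 mulr0 subr0.
rewrite factS natrM lnM ?posrE ?ltr0n ?fact_gt0 //.
have N0 : 0 < n.+2%:R :> R by rewrite ltr0n.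
have : ln (1 - n.+2%:R^-1) <= - n.+2%:R^-1 :> R.
  by rewrite le_ln1Dx // ltrN2 invf_lt1 // ltr1n.
have -> : 1 - n.+2%:R^-1 = n.+1%:R / n.+2%:R :> R.
  by rewrite -[n.+2]addn1 natrD; field; rewrite -natr1 in N0; rewrite gt_eqF // -natr1.
rewrite ln_div ?posrE ?ltr0n // -(ler_pM2l N0) mulrN divff ?gt_eqF //.
move: IH; rewrite -[n.+2]addn1 -[n.+1]addn1 !natrD; nra.
Qed.

Lemma ln_bin_ge (g r : nat) :
  (g + r)%:R * ln (g + r)%:R - g.+1%:R * ln g.+1%:R - r.+1%:R * ln r.+1%:R
  <= ln 'C(g + r, g)%:R :> R.
Proof.
have H := ln_fact_ge (g + r).
have Hg := ln_fact_le g.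
have Hr := ln_fact_le r.
have := bin_fact (leq_addr r g); rewrite addKn => E.
have : ln ('C(g + r, g) * (g`! * r`!))%:R = ln (g + r)`!%:R :> R by rewrite E.
rewrite !natrM !lnM ?posrE ?mulr_gt0 ?ltr0n ?fact_gt0 ?bin_gt0 ?leq_addr //.
move: H; rewrite [X in _ - X <= _]natrD; lra.
Qed.

(** The bound of [ln_bin_ge] divided by [g] and written in the ratio [r / g], so that limits can be
    taken termwise. The coefficients of [ln g] add up to -2, whence the last term. *)
Definition bin_rate (g r : nat) : R :=
  (1 + r%:R / g%:R) * ln (1 + r%:R / g%:R)
  - (1 + g%:R^-1) * ln (1 + g%:R^-1)
  - (r%:R / g%:R + g%:R^-1) * ln (r%:R / g%:R + g%:R^-1)
  - 2 * (ln g%:R / g%:R).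

Lemma bin_rate_le (g r : nat) : (0 < g)%N ->
  bin_rate g r * g%:R <= ln 'C(g + r, g)%:R.
Proof.
move=> g0; apply: le_trans (ln_bin_ge g r); rewrite /bin_rate.
have G0 : 0 < g%:R :> R by rewrite ltr0n.
have -> : 1 + r%:R / g%:R = (g + r)%:R / g%:R :> R.
  by rewrite natrD; field; rewrite gt_eqF.
have -> : 1 + g%:R^-1 = g.+1%:R / g%:R :> R.
  by rewrite -addn1 natrD; field; rewrite gt_eqF.
have -> : r%:R / g%:R + g%:R^-1 = r.+1%:R / g%:R :> R.
  by rewrite -addn1 natrD; field; rewrite gt_eqF.
rewrite !ln_div ?posrE ?ltr0n ?addn_gt0 ?g0 //.
rewrite le_eqVlt; apply/orP; left; apply/eqP.
by rewrite -[g.+1]addn1 -[r.+1]addn1 !natrD; field; rewrite gt_eqF.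
Qed.

Lemma cvg_xlnx x (u : nat -> R) : 0 < x -> u n @[n --> \oo] --> x ->
  u n * ln (u n) @[n --> \oo] --> x * ln x.
Proof.
move=> x0 ux; apply: cvgM => //.
exact: (cvg_comp _ _ ux (continuous_ln x0)).
Qed.

Lemma cvg_natV : (n%:R : R)^-1 @[n --> \oo] --> (0 : R).
Proof.
have pos : \forall n \near \oo, 0 < n%:R :> R.
  by near=> n; rewrite ltr0n; near: n; exact: nbhs_infty_gt.
by apply/(gtr0_cvgV0 pos); exact: cvgr_idn.
Unshelve. all: by end_near. Qed.

Lemma cvg_sqrt (u : nat -> R) x : u n @[n --> \oo] --> x ->
  Num.sqrt (u n) @[n --> \oo] --> Num.sqrt x.
Proof. by move=> ux; exact: (cvg_comp _ _ ux (@sqrt_continuous R x)). Qed.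

Lemma cvg_lnn_div : ln n%:R / n%:R @[n --> \oo] --> (0 : R).
Proof.
apply: (squeeze_cvgr (f := fun=> 0) (h := fun n => 2 * Num.sqrt n%:R^-1)).
- near=> n; have n0 : (0 < n)%N by near: n; exact: nbhs_infty_gt.
  have N0 : 0 < n%:R :> R by rewrite ltr0n.
  rewrite divr_ge0 ?ln_ge0 ?ler1n //= ler_pdivrMr // -mulrA.
  have -> : Num.sqrt n%:R^-1 * n%:R = Num.sqrt n%:R :> R.
    rewrite -{2}[n%:R](@sqr_sqrtr R) ?ler0n // sqrtrV // expr2 mulrA mulVf ?mul1r //.
    by rewrite gt_eqF // sqrtr_gt0.
  apply: le_trans (ln1D_le_sqrt (ltW N0)).
  by rewrite ler_ln ?posrE ?addr_gt0 // lerDr.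
- exact: cvg_cst.
- rewrite -[X in _ --> X](mulr0 2); apply: cvgM; first exact: cvg_cst.
  rewrite -[X in _ --> X](@sqrtr0 R); apply: cvg_sqrt; exact: cvg_natV.
Unshelve. all: by end_near. Qed.

Lemma cvg_truncn_div rho : 0 < rho ->
  (Num.truncn (rho * n%:R))%:R / n%:R @[n --> \oo] --> rho.
Proof.
move=> rho0; apply: (squeeze_cvgr (f := fun n => rho - n%:R^-1) (h := fun=> rho)).
- near=> n; have n0 : (0 < n)%N by near: n; exact: nbhs_infty_gt.
  have N0 : 0 < n%:R :> R by rewrite ltr0n.
  have r0 : 0 <= rho * n%:R by rewrite mulr_ge0 // ltW.
  have /andP[h1 h2] := truncn_itv r0.
  rewrite ler_pdivrMr // h1 andbT ler_pdivlMr // mulrBl mulVf ?gt_eqF //.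
  by rewrite lerBlDr natr1 ltW.
- rewrite -[X in _ --> X]subr0; apply: cvgB; first exact: cvg_cst.
  exact: cvg_natV.
- exact: cvg_cst.
Unshelve. all: by end_near. Qed.

(* [g] and [r] at density [rho]: the exponential growth rate is that of the
   geometric distribution of mean [rho]. *)
Lemma cvg_bin_rate rho : 0 < rho ->
  bin_rate g (Num.truncn (rho * g%:R)) @[g --> \oo] -->
  (1 + rho) * ln (1 + rho) - rho * ln rho.
Proof.
move=> rho0; have ct := cvg_truncn_div rho0.
have -> : (1 + rho) * ln (1 + rho) - rho * ln rho =
  (1 + rho) * ln (1 + rho) - (1 + 0) * ln (1 + 0) - (rho + 0) * ln (rho + 0) - 2 * 0.
  by rewrite !addr0 ln1 !mulr0 !subr0.
rewrite /bin_rate; apply: cvgB; last by apply: cvgM; [exact: cvg_cst|exact: cvg_lnn_div].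
apply: cvgB; first apply: cvgB.
- apply: cvg_xlnx; first by rewrite addr_gt0.
  by apply: cvgD => //; exact: cvg_cst.
- apply: cvg_xlnx; first by rewrite addr0.
  by apply: cvgD; [exact: cvg_cst|exact: cvg_natV].
- apply: cvg_xlnx; first by rewrite addr0.
  by apply: cvgD => //; exact: cvg_natV.
Qed.

(* The density rho_(i+1): blocks are numbered from 0. *)
Definition occ a (i : nat) : R := (expR (a * i.+1%:R) - 1)^-1.

Lemma occ_gt0 a i : 0 < a -> 0 < occ a i.
Proof.
by move=> a0; rewrite invr_gt0 subr_gt0 expR_gt1 mulr_gt0.
Qed.

(** With [rho = occ a i] and [x = a * i.+1], one has [1 + rho = expR x * rho], so
    [ln rho = ln (1 + rho) - x]. The entropy thus mirrors the upper bound [L_le]: a [bose] value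
    plus [a] times a covering cost. *)
Lemma entropy_occ a i : 0 < a ->
  (1 + occ a i) * ln (1 + occ a i) - occ a i * ln (occ a i) =
  bose (a * i.+1%:R) + a * (i.+1%:R * occ a i).
Proof.
move=> a0; have p0 := occ_gt0 i a0; rewrite boseE ?mulr_gt0 ?ltr0n // -/(occ a i).
set x := a * i.+1%:R; set l := ln (1 + _).
have -> : ln (occ a i) = l - x.
  rewrite /l -[x]expRK -ln_div ?posrE ?addr_gt0 ?expR_gt0 //; congr ln.
  have x1 : expR x - 1 != 0.
    by rewrite gt_eqF // subr_gt0 expR_gt1 /x mulr_gt0.
  by rewrite /occ -/x; field; rewrite x1 gt_eqF // expR_gt0.
rewrite mulrA -/x; ring.
Qed.

(** Up to lower order, [g ^+ 2] times this bounds how often a point is covered. *)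
Definition cov_occ a (N : nat) : R := \sum_(i < N) i.+1%:R * occ a i.

Lemma L_ge0 (h w : nat) : 0 <= L h w :> R.
Proof.
rewrite /L; set K := num_kostant _.
have [->|K0] := posnP K; first by rewrite ln0.
by rewrite ln_ge0 // ler1n.
Qed.

(** This is [num_kostant_ge_bin] with [w - N * g] starting points; the [g.+1] in the hypothesis
    absorbs the extra 1 in [(i.+1 * g).+1]. *)
Lemma L_ge_thin a (N h w g : nat) : 0 < a ->
  g.+1%:R ^+ 2 * cov_occ a N <= h%:R ->
  (w%:R - (N * g)%:R) *
    \sum_(i < N) ln 'C(g + Num.truncn (occ a i * g%:R), g)%:R <= L h w :> R.
Proof.
move=> a0 gh.
have lb i : 0 <= ln 'C(g + Num.truncn (occ a i * g%:R), g)%:R :> R.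
  by rewrite ln_ge0 // ler1n bin_gt0 leq_addr.
(* If [w < N * g], the real factor is negative while [L] is nonnegative. *)
have [Ngw|wNg] := leqP (N * g) w; last first.
  apply: le_trans (L_ge0 _ _).
  rewrite mulr_le0_ge0 ?sumr_ge0 // subr_le0 ler_nat; exact: ltnW.
rewrite -natrB //.
have := @num_kostant_ge_bin h w (w - N * g) N g (fun i => Num.truncn (occ a i * g%:R)).
rewrite subnK // => /(_ (leqnn _)) H.
have {}/H H : (\sum_(i < N) Num.truncn (occ a i * g%:R) * (i.+1 * g).+1 <= h)%N.
  have [->|g0] := posnP g.
    by rewrite big1 // => i _; rewrite mulr0 truncn0.
  rewrite -(ler_nat R); apply: le_trans gh.
  rewrite natr_sum mulr_sumr; apply: ler_sum => i _.
  have p0 := occ_gt0 i a0.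
  rewrite natrM; apply: (@le_trans _ _ (occ a i * g%:R * (i.+1 * g.+1)%:R)).
    apply: ler_pM => //; last by rewrite ler_nat mulnS -add1n leq_add2r.
    by rewrite truncn_le mulr_ge0 // ltW.
  rewrite natrM; have : g%:R <= g.+1%:R :> R by rewrite ler_nat.
  have : 0 <= i.+1%:R * occ a i * g.+1%:R :> R by rewrite !mulr_ge0 // ltW.
  nra.
have P0 : (0 < \prod_(i < N) 'C(g + Num.truncn (occ a i * g%:R), g))%N.
  by rewrite prodn_gt0 // => i; rewrite bin_gt0 leq_addr.
rewrite /L; apply: (@le_trans _ _
  (ln ((\prod_(i < N) 'C(g + Num.truncn (occ a i * g%:R), g)) ^ (w - N * g))%:R)); last first.
  have Q0 : (0 < (\prod_(i < N) 'C(g + Num.truncn (occ a i * g%:R), g)) ^ (w - N * g))%N.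
    by rewrite expn_gt0 P0.
  by rewrite ler_ln ?posrE ?ltr0n ?ler_nat //; exact: leq_trans H.
rewrite natrX lnXn ?ltr0n // -[leRHS]mulr_natl ler_wpM2l //.
rewrite le_eqVlt; apply/orP; left; apply/eqP; symmetry.
suff [] : 0 < (\prod_(i < N) 'C(g + Num.truncn (occ a i * g%:R), g))%:R :> R /\
    ln (\prod_(i < N) 'C(g + Num.truncn (occ a i * g%:R), g))%:R =
    \sum_(i < N) ln 'C(g + Num.truncn (occ a i * g%:R), g)%:R :> R by [].
apply: (big_ind2 (fun (p : nat) s => 0 < p%:R :> R /\ ln p%:R = s)); first by rewrite ln1.
- by move=> p1 s1 p2 s2 [p10 <-] [p20 <-]; rewrite natrM mulr_gt0 // lnM.
- by move=> i _; rewrite ltr0n bin_gt0 leq_addr.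
Qed.

Definition thin_rate a (N : nat) : R :=
  (\sum_(i < N) bose (a * i.+1%:R) + a * cov_occ a N) / Num.sqrt (cov_occ a N).

Lemma cov_occ_gt0 a N : 0 < a -> (0 < N)%N -> 0 < cov_occ a N.
Proof.
move=> a0; case: N => // N _; rewrite /cov_occ big_ord_recl /=.
rewrite ltr_wpDr ?mulr_gt0 ?occ_gt0 //.
by apply: sumr_ge0 => i _; rewrite mulr_ge0 // ltW // occ_gt0.
Qed.

Lemma thin_rate_ge a N : 0 < a -> (0 < N)%N ->
  2 * Num.sqrt (riemann a N) <= thin_rate a N.
Proof.
move=> a0 N0; have C0 := cov_occ_gt0 a0 N0.
rewrite /thin_rate /riemann; set S := \sum_(i < N) _; set C := cov_occ a N in C0 *.
have S0 : 0 <= S by apply: sumr_ge0 => i _; exact: bose_ge0.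
rewrite ler_pdivlMr ?sqrtr_gt0 // -mulrA -sqrtrM; last by rewrite mulr_ge0 // ltW.
have -> : a * S * C = S * (a * C) by ring.
rewrite sqrtrM //.
have := sqr_sqrtr S0; have := @sqr_sqrtr R (a * C) ltac:(by rewrite mulr_ge0 // ltW).
set u := Num.sqrt S; set v := Num.sqrt _ => v2 u2.
have := sqr_ge0 (u - v); rewrite sqrrB u2 v2; lra.
Qed.
End thin.
(** * Asymptotics *)

Section asymptotics.
Local Open Scope classical_set_scope.
Context {R : realType}.
Implicit Types (a c : R) (h w : nat -> nat).

(** Positivity of [h] enters because [1 / 0 = 0]: the ratio also tends to 0 for [h = 0]. *)
Lemma asym_prec1_cvgy h : (forall n, (0 < n)%N -> (0 < h n)%N) ->
  asym_prec (fun _ => 1 : R) (fun n => (h n)%:R) ->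
  (h n)%:R @[n --> \oo] --> (+oo : set_system R).
Proof.
move=> h0; rewrite /asym_prec => H.
have pos : \forall n \near \oo, 0 < (h n)%:R :> R.
  by near=> n; rewrite ltr0n h0 //; near: n; exact: nbhs_infty_gt.
apply/(gtr0_cvgV0 pos); move: H.
suff -> : (fun n => 1 / (h n)%:R) = (fun n => ((h n)%:R : R)^-1) by [].
by apply/funext => n; rewrite div1r.
Unshelve. all: by end_near. Qed.

Lemma cvgy_sqrt (u : nat -> R) : u n @[n --> \oo] --> +oo ->
  Num.sqrt (u n) @[n --> \oo] --> +oo.
Proof.
move=> /cvgryPge uy; apply/cvgryPge => A; near=> n.
apply: (@le_trans _ _ (Num.norm A)); first exact: ler_norm.
by rewrite -sqrtr_sqr ler_wsqrtr //; near: n; exact: uy.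
Unshelve. all: by end_near. Qed.

(** Some Riemann sum exceeds [(1 - e) * riemann_sup], and for [e < 1] its root loses no more than
    that factor since [1 - e <= Num.sqrt (1 - e)]. *)
Lemma thin_rate_sup (e : R) : 0 < e ->
  exists a N, [/\ 0 < a, (0 < N)%N &
    (1 - e) * (2 * Num.sqrt riemann_sup) < thin_rate a N].
Proof.
move=> e0; have G0 : 0 < riemann_sup :> R := riemann_sup_gt0.
have [e1|e1] := ltP e 1; last first.
  exists 1, 1%N; split => //; apply: le_lt_trans (_ : 0 < _).
    by rewrite mulr_le0_ge0 ?subr_le0 // mulr_ge0 // sqrtr_ge0.
  apply: lt_le_trans (thin_rate_ge ltr01 _) => //.
  by rewrite mulr_gt0 // sqrtr_gt0 /riemann big_ord1 !mul1r bose_gt0.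
have [_ [a [N [a0 ->]]] H] := sup_adherent (mulr_gt0 e0 G0) has_sup_riemann.
rewrite -/riemann_sup in H.
have {}H : riemann_sup * (1 - e) < riemann a N by rewrite mulrBr mulr1 [_ * e]mulrC.
have f0 : 0 < 1 - e by rewrite subr_gt0.
have N0 : (0 < N)%N.
  rewrite lt0n; apply/eqP => N0; move: H; rewrite N0 /riemann big_ord0 mulr0.
  by rewrite ltNge ltW // mulr_gt0.
exists a, N; split => //; apply: lt_le_trans (thin_rate_ge a0 N0).
rewrite mulrCA ltr_pM2l //.
apply: le_lt_trans (_ : Num.sqrt (riemann_sup * (1 - e)) < _); last first.
  by rewrite ltr_sqrt // (lt_trans _ H) // mulr_gt0.
rewrite mulrC (sqrtrM _ (ltW G0)) ler_pM2l ?sqrtr_gt0 //.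
rewrite -{1}(sqr_sqrtr (ltW f0)) expr2 -[leRHS]mulr1 ler_pM2l ?sqrtr_gt0 //.
by rewrite -[leRHS](@sqrtr1 R) ler_wsqrtr // gerBl ltW.
Qed.

(** For fixed [a] and [N], the lower bound divided by [w * q] is a product of three convergent
    factors: [z], [g / q] and the sum [E] of block rates. *)
Lemma L_thin_near a (N : nat) h w c : 0 < a -> (0 < N)%N ->
  (forall n, (0 < n)%N -> (0 < h n)%N) ->
  (forall n, (0 < n)%N -> (0 < w n)%N) ->
  asym_prec (fun _ => 1 : R) (fun n => (h n)%:R) ->
  asym_prec (fun n => Num.sqrt (h n)%:R : R) (fun n => (w n)%:R) ->
  c < thin_rate a N ->
  \forall n \near \oo, c * ((w n)%:R * Num.sqrt (h n)%:R) <= L (h n) (w n).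
Proof.
move=> a0 N0 h0 w0 hy hw cr.
set C := cov_occ a N; have C0 : 0 < C := cov_occ_gt0 a0 N0.
have s0 : 0 < Num.sqrt C by rewrite sqrtr_gt0.
pose q n : R := Num.sqrt (h n)%:R.
(* Subtracting 1 first ensures [(g n).+1 <= q n / Num.sqrt C] once the argument is nonnegative, as
   [L_ge_thin] demands. *)
pose g n := Num.truncn (q n / Num.sqrt C - 1).
have qy : q n @[n --> \oo] --> +oo by apply: cvgy_sqrt; exact: asym_prec1_cvgy.
have q1 : \forall n \near \oo, 1 <= q n / Num.sqrt C.
  near=> n; rewrite ler_pdivlMr // mul1r; near: n.
  by move/cvgryPge : qy => /(_ (Num.sqrt C)).
have gle n : 1 <= q n / Num.sqrt C ->
    q n / Num.sqrt C - 2 <= (g n)%:R <= q n / Num.sqrt C - 1.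
  move=> qn1; have qn0 : 0 <= q n / Num.sqrt C - 1 by rewrite subr_ge0.
  have := truncn_itv qn0; rewrite -/(g n) -natr1 => /andP[g1 g2].
  by rewrite g1 andbT; lra.
have gy : g n @[n --> \oo] --> \oo.
  apply/(@cvgrnyP R)/cvgryPge => A; near=> n.
  apply: (@le_trans _ _ (q n / Num.sqrt C - 2)).
    rewrite lerBrDr ler_pdivlMr //; near: n.
    by move/cvgryPge : qy => /(_ ((A + 2) * Num.sqrt C)).
  by have /andP[] : q n / Num.sqrt C - 2 <= (g n)%:R <= q n / Num.sqrt C - 1
    by apply: gle; near: n.
have q0 : \forall n \near \oo, 0 < q n.
  by move/cvgryPgt : qy => /(_ 0).
have qV : (q n)^-1 @[n --> \oo] --> (0 : R) by apply/(gtr0_cvgV0 q0).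
have gq : (g n)%:R / q n @[n --> \oo] --> (Num.sqrt C)^-1.
  apply: (squeeze_cvgr (f := fun n => (Num.sqrt C)^-1 - 2 * (q n)^-1)
    (h := fun=> (Num.sqrt C)^-1)).
  - near=> n; have qn0 : 0 < q n by near: n.
    have /andP[g1 g2] : q n / Num.sqrt C - 2 <= (g n)%:R <= q n / Num.sqrt C - 1.
      by apply: gle; near: n.
    rewrite ler_pdivlMr // ler_pdivrMr // mulrBl -mulrA mulVf ?gt_eqF // mulr1.
    by rewrite mulrC; apply/andP; split; lra.
  - rewrite -[X in _ --> X]subr0 -[X in _ - X](mulr0 2).
    by apply: cvgB; [exact: cvg_cst|apply: cvgM => //; exact: cvg_cst].
  - exact: cvg_cst.
(* The share of starting points left after giving up [N * g n] of them; it tends to 1 because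
   [q n / w n] tends to 0. *)
pose z n : R := 1 - N%:R * ((g n)%:R / q n * (q n / (w n)%:R)).
have zc : z n @[n --> \oo] --> (1 : R).
  rewrite /z -[X in _ --> X]subr0 -[X in _ - X](mulr0 N%:R) -[X in _ * X](mulr0 (Num.sqrt C)^-1).
  apply: cvgB; first exact: cvg_cst.
  by apply: cvgM; [exact: cvg_cst|exact: cvgM].
pose E n : R := \sum_(i < N) bin_rate (g n) (Num.truncn (occ a i * (g n)%:R)).
have Ec : E n @[n --> \oo] --> \sum_(i < N) (bose (a * i.+1%:R) + a * (i.+1%:R * occ a i)).
  apply: cvg_big; first exact: add_continuous.
  move=> i _; rewrite -entropy_occ //.
  exact: (cvg_comp _ _ gy (cvg_bin_rate (occ_gt0 i a0))).
have Bc : z n * ((g n)%:R / q n * E n) @[n --> \oo] --> thin_rate a N.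
  rewrite [X in _ --> X](_ : _ = 1 * ((Num.sqrt C)^-1 *
     \sum_(i < N) (bose (a * i.+1%:R) + a * (i.+1%:R * occ a i)))).
    by apply: cvgM => //; apply: cvgM.
  by rewrite mul1r big_split /= -mulr_sumr mulrC.
near=> n.
have n0 : (0 < n)%N by near: n; exact: nbhs_infty_gt.
have W0 : 0 < (w n)%:R :> R by rewrite ltr0n w0.
have qn0 : 0 < q n by near: n.
have gn0 : (0 < g n)%N by near: n; move/cvgnyPgt : gy => /(_ 0%N).
have qn1 : 1 <= q n / Num.sqrt C by near: n.
have cB : c < z n * ((g n)%:R / q n * E n) by near: n; exact: (cvgr_gt _ Bc).
have z0 : 0 < z n by near: n; exact: (cvgr_gt _ zc).
apply: (@le_trans _ _ (z n * ((g n)%:R / q n * E n) * ((w n)%:R * q n))).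
  by rewrite ler_pM2r ?mulr_gt0 // ltW.
apply: le_trans (@L_ge_thin _ a N (h n) (w n) (g n) a0 _); last first.
  have /andP[_ g2] := gle _ qn1; rewrite -/C.
  have -> : (h n)%:R = (q n / Num.sqrt C) ^+ 2 * C :> R.
    rewrite exprMn exprVn (sqr_sqrtr (ltW C0)) /q sqr_sqrtr //.
    by rewrite mulfVK // gt_eqF.
  have x0 := le_trans ler01 qn1.
  rewrite ler_pM2r // ler_pXn2r ?nnegrE //.
  by rewrite -natr1; lra.
have -> : z n * ((g n)%:R / q n * E n) * ((w n)%:R * q n) =
  (z n * (w n)%:R) * (E n * (g n)%:R) by field; rewrite gt_eqF.
have -> : (w n)%:R - (N * g n)%:R = z n * (w n)%:R :> R.
  by rewrite /z natrM; field; rewrite !gt_eqF.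
rewrite ler_pM2l ?mulr_gt0 // /E mulr_suml; apply: ler_sum => i _.
exact: bin_rate_le.
Unshelve. all: by end_near. Qed.

Lemma asym_thin h w :
  (forall n, (0 < n)%N -> (0 < h n)%N) ->
  (forall n, (0 < n)%N -> (0 < w n)%N) ->
  asym_prec (fun _ => 1 : R) (fun n => (h n)%:R) ->
  asym_prec (fun n => Num.sqrt (h n)%:R : R) (fun n => (w n)%:R) ->
  asym_equiv (fun n => L (h n) (w n) : R)
    (fun n => 2 * Num.sqrt riemann_sup * (w n)%:R * Num.sqrt (h n)%:R).
Proof.
move=> h0 w0 hy hw; apply/cvgrPdist_le => e e0.
have [a [N [a0 N0 aN]]] := thin_rate_sup e0.
have G0 : 0 < Num.sqrt riemann_sup :> R by rewrite sqrtr_gt0 riemann_sup_gt0.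
near=> n.
have n0 : (0 < n)%N by near: n; exact: nbhs_infty_gt.
have W0 : 0 < (w n)%:R :> R by rewrite ltr0n w0.
have Q0 : 0 < Num.sqrt (h n)%:R :> R by rewrite sqrtr_gt0 ltr0n h0.
have D0 : 0 < 2 * Num.sqrt riemann_sup * (w n)%:R * Num.sqrt (h n)%:R :> R.
  by rewrite !mulr_gt0.
have up := @L_le_thin R (h n) (w n) (h0 _ n0).
have lo : (1 - e) * (2 * Num.sqrt riemann_sup) * ((w n)%:R * Num.sqrt (h n)%:R)
    <= L (h n) (w n) by near: n; exact: (L_thin_near a0 N0 h0 w0 hy hw aN).
(* By [up] the ratio is at most 1, which fixes the sign of the difference. *)
rewrite ger0_norm; last by rewrite subr_ge0 ler_pdivrMr // mul1r.
rewrite lerBlDl -lerBlDr ler_pdivlMr //; apply: le_trans lo.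
by rewrite !mulrA.
Unshelve. all: by end_near. Qed.

Lemma bin2_natr (w : nat) : 'C(w, 2)%:R = w%:R * (w%:R - 1) / 2 :> R.
Proof.
elim: w => [|w IH]; first by rewrite !mul0r.
by rewrite binS bin1 natrD IH -[w.+1]addn1 natrD; field.
Qed.

(** The two binomials differ from [w ^+ 2 / 2] by a relative error [1 / w], and the term
    [5 * w ^+ 2] is negligible because [l] tends to infinity. *)
Lemma asym_thick h w :
  (forall n, (0 < n)%N -> (0 < h n)%N) ->
  (forall n, (0 < n)%N -> (0 < w n)%N) ->
  asym_prec (fun _ => 1 : R) (fun n => (w n)%:R) ->
  asym_prec (fun n => (w n)%:R : R) (fun n => Num.sqrt (h n)%:R) ->
  asym_equiv (fun n => L (h n) (w n) : R)
    (fun n => (w n)%:R ^+ 2 * ln (Num.sqrt (h n)%:R / (w n)%:R)).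
Proof.
move=> h0 w0 wy wh.
pose l n : R := ln (Num.sqrt (h n)%:R / (w n)%:R).
have ly : l n @[n --> \oo] --> +oo.
  apply/cvgryPge => A; near=> n.
  have n0 : (0 < n)%N by near: n; exact: nbhs_infty_gt.
  have W0 : 0 < (w n)%:R :> R by rewrite ltr0n w0.
  have Q0 : 0 < Num.sqrt (h n)%:R :> R by rewrite sqrtr_gt0 ltr0n h0.
  rewrite -ler_expR lnK ?posrE ?divr_gt0 //.
  rewrite -[leRHS]invf_div -[leLHS]invrK -expRN lef_pV2 ?posrE ?divr_gt0 ?expR_gt0 //.
  by apply: ltW; near: n; apply: (cvgr_lt _ wh); exact: expR_gt0.
have l0 : \forall n \near \oo, 0 < l n by move/cvgryPgt : ly => /(_ 0).
have lV : (l n)^-1 @[n --> \oo] --> (0 : R) by apply/(gtr0_cvgV0 l0).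
apply: (squeeze_cvgr (f := fun n => 1 - 1 / (w n)%:R)
  (h := fun n => 1 + 1 / (w n)%:R + 5 * (l n)^-1)).
- near=> n.
  have n0 : (0 < n)%N by near: n; exact: nbhs_infty_gt.
  have W0 : 0 < (w n)%:R :> R by rewrite ltr0n w0.
  have H0 : 0 < (h n)%:R :> R by rewrite ltr0n h0.
  have Q0 : 0 < Num.sqrt (h n)%:R :> R by rewrite sqrtr_gt0.
  have ln0 : 0 < l n by near: n.
  (* The factor 2 cancels the halves in the binomials. *)
  have lE : ln ((h n)%:R / (w n)%:R ^+ 2) = 2 * l n.
    rewrite -[(h n)%:R]sqr_sqrtr // -expr_div_n lnXn ?divr_gt0 //.
    by rewrite mulr_natl.
  have wh1 : (w n * w n <= h n)%N.
    rewrite -(ler_nat R) natrM -[leRHS]sqr_sqrtr // -expr2.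
    rewrite ler_pXn2r ?nnegrE ?ltW // -[ltRHS]mul1r -ltr_pdivrMr //.
    by near: n; exact: (cvgr_lt _ wh).
  have D0 : 0 < (w n)%:R ^+ 2 * l n by rewrite mulr_gt0 // exprn_gt0.
  have lo := @L_ge_thick R _ _ (w0 _ n0) (h0 _ n0).
  have up := @L_le_thick R _ _ (w0 _ n0) wh1.
  rewrite -/(l n) ler_pdivlMr // ler_pdivrMr //; apply/andP; split.
    apply: le_trans lo; rewrite lE bin2_natr.
    by rewrite le_eqVlt; apply/orP; left; apply/eqP; field; rewrite gt_eqF.
  apply: (le_trans up); rewrite lE bin2_natr.
  rewrite -[(w n).+1]addn1 natrD.
  by rewrite le_eqVlt; apply/orP; left; apply/eqP; field; rewrite !gt_eqF.
- by rewrite -[X in _ --> X]subr0; apply: cvgB; [exact: cvg_cst|exact: wy].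
- rewrite -[X in _ --> X]addr0 -[X in _ + X](mulr0 5) -[X in X + _]addr0.
  apply: cvgD; last by apply: cvgM => //; exact: cvg_cst.
  by apply: cvgD; [exact: cvg_cst|exact: wy].
Unshelve. all: by end_near. Qed.

End asymptotics.

Theorem theorem2p12 (R : realType) :
  exists gamma : R,
  forall h w : nat -> nat,
    (forall n : nat, (0 < n)%N -> (0 < h n)%N) ->
    (forall n : nat, (0 < n)%N -> (0 < w n)%N) ->
    asym_prec (fun _ : nat => (1 : R)) (fun n => (h n)%:R) ->
    asym_prec (fun _ : nat => (1 : R)) (fun n => (w n)%:R) ->
    (asym_prec (fun n => (w n)%:R : R) (fun n => Num.sqrt (h n)%:R) ->
     asym_equiv (fun n => L (h n) (w n) : R)
       (fun n => (w n)%:R ^+ 2 * ln (Num.sqrt (h n)%:R / (w n)%:R)))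
    /\
    (asym_prec (fun n => Num.sqrt (h n)%:R : R) (fun n => (w n)%:R) ->
     asym_equiv (fun n => L (h n) (w n) : R)
       (fun n => gamma * (w n)%:R * Num.sqrt (h n)%:R)).
Proof.
exists (2 * Num.sqrt riemann_sup) => h w h0 w0 hy wy; split => [wh|hw].
- exact: asym_thick.
- exact: asym_thin.
Qed.
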